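(* Let $\omega$ be the symmetric sum, $\omega(x,y,z) = x(y\circ z) + y(z\circ x) + z(x\circ y)$, where $u \circ v = \tfrac12(uv+vu)$. The center of $U(A^\omega)$ is the polynomial algebra in the elements $\mathcal{Z}(m)$, $m \ge 2$: \[ Z(U(A^\omega)) = \mathbb{F}[\,\mathcal{Z}(m) \mid m\ge 2\,]. \]
   Context: $\mathbb{F}$ is a field of characteristic $0$. $A$ is the 2-dimensional space of $2\times 2$ matrices over $\mathbb{F}$ with zero diagonal, with basis $e_1 = \begin{bmatrix} 0&1\\0&0\end{bmatrix}$, $e_2 = \begin{bmatrix} 0&0\\1&0\end{bmatrix}$; it is closed under triple products $xyz$ of matrices. For a trilinear operation $\omega(x,y,z)$ (a fixed rational linear combination of the six products of $x,y,z$ in all orders), $A^\omega$ denotes the space $A$ with the trilinear operation $\omega$ computed using matrix multiplication. Let $\mathbb{F}\langle a,b\rangle$ be the free unital associative algebra and $\phi\colon A \to \mathbb{F}\langle a,b\rangle$ the linear map with $\phi(e_1)=a$, $\phi(e_2)=b$. The universal associative envelope is $U(A^\omega) = \mathbb{F}\langle a,b\rangle / I$, where $I$ is the two-sided ideal generated by the elements $\omega(\phi(x),\phi(y),\phi(z)) - \phi(\omega(x,y,z))$ for $x,y,z\in\{e_1,e_2\}$. The cosets of $a,b$ in $U(A^\omega)$ are again written $a,b$. For $m\ge 2$ define integers $\gamma_1(m),\dots,\gamma_4(m)$ as follows. If $m$ is even: $\gamma_1(m)=m+1$, $\gamma_2(m)=-3$, $\gamma_3(m)=0$, $\gamma_4(m)=-m+2$.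 If $m$ is odd: $\gamma_1(m)=-(m-3)$, $\gamma_2(m)=-1$, $\gamma_3(m)=-2$, $\gamma_4(m)=m$. Define \[ \begin{aligned} \mathcal{Z}(m) ={}& \widehat{\delta}_{m,2}\sum_{j=1}^{m-2} (-1)^{j+1}\binom{m-1}{j-1}\left( (ba)^j - a(ba)^{j-1}b\right) + \gamma_1(m)(ba)^{m-1} + \gamma_2(m)(ba)^m \\ &+ \gamma_3(m)\, a(ba)^{m-1}b + \gamma_4(m)\, a(ba)^{m-2}b + 3a^2(ba)^{m-2}b^2, \end{aligned} \] where $\widehat{\delta}_{m,2}=0$ if $m=2$ and $1$ otherwise.
   Formalization: ''Polynomial algebra in the elements Z(m)'' is read as the unital subalgebra generated by the Z(m); algebraic independence is not claimed, since it fails: Z(2)^2 = 3Z(3) - 3Z(4). *)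

(* Defs.v *)
From HB Require Import structures.
From mathcomp Require Import all_boot all_algebra.
From mathcomp Require Import monalg.
From mathcomp Require Import boolp.

Set Implicit Arguments.
Unset Strict Implicit.
Unset Printing Implicit Defensive.

Import GRing.Theory.
Local Open Scope ring_scope.
Local Open Scope quotient_scope.

Section Algebras.
Variables (F : fieldType) (B : algType F).

Definition centre (x : B) : Prop := forall y : B, GRing.comm x y.

(* The unital subalgebra F[S]. For the elements Z(m) below it is not a free
   commutative algebra: for instance Z(2)^2 = 3 Z(3) - 3 Z(4). *)
Inductive subalg_gen (S : B -> Prop) : B -> Prop :=
| SubalgGen x of S x : subalg_gen S x
| SubalgOne : subalg_gen S 1
| SubalgScale c x of subalg_gen S x : subalg_gen S (c *: x)
| SubalgAdd x y of subalg_gen S x & subalg_gen S y : subalg_gen S (x + y)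
| SubalgMul x y of subalg_gen S x & subalg_gen S y : subalg_gen S (x * y).

Inductive ideal_gen (S : B -> Prop) : B -> Prop :=
| IdealGen x of S x : ideal_gen S x
| IdealZero : ideal_gen S 0
| IdealAdd x y of ideal_gen S x & ideal_gen S y : ideal_gen S (x + y)
| IdealMulL c x of ideal_gen S x : ideal_gen S (c * x)
| IdealMulR c x of ideal_gen S x : ideal_gen S (x * c).

Definition circ (u v : B) : B := 2^-1 *: (u * v + v * u).

Definition symsum (x y z : B) : B :=
  x * circ y z + y * circ z x + z * circ x y.

End Algebras.

(* Quotients of an algebra by a proper two-sided ideal; the library only gives
   a ring structure to quotients of commutative rings. *)
Section QuotientAlgebra.
Variables (F : fieldType) (B : algType F).

Record ideal2 := Ideal2 {
  ideal2_pred :> {pred B};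
  ideal2_zmod_closed : zmod_closed ideal2_pred;
  ideal2_mull : forall c x, x \in ideal2_pred -> c * x \in ideal2_pred;
  ideal2_mulr : forall c x, x \in ideal2_pred -> x * c \in ideal2_pred;
  ideal2_proper : 1 \notin ideal2_pred
}.

Variable I : ideal2.

HB.instance Definition _ :=
  GRing.isZmodClosed.Build B (ideal2_pred I) (ideal2_zmod_closed I).

Definition quot_alg := Quotient.quot (ideal2_pred I).

HB.instance Definition _ := GRing.Zmodule.on quot_alg.
HB.instance Definition _ := EqQuotient.on quot_alg.

Local Notation pi := (\pi_quot_alg).

Lemma quot_algP (x y : B) : reflect (pi x = pi y) (x - y \in ideal2_pred I).
Proof. by rewrite Quotient.idealrBE; exact: eqP. Qed.

Lemma repr_pi_quot_alg (x : B) : repr (pi x) - x \in ideal2_pred I.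
Proof. by apply/quot_algP; rewrite reprK. Qed.

Lemma pi_quot_algD : {morph pi : x y / x + y}.
Proof. exact: (@Quotient.pi_add _ (ideal2_pred I)). Qed.

Definition quot_alg_one : quot_alg := pi 1.
Definition quot_alg_mul := lift_op2 quot_alg *%R.
Definition quot_alg_scale (c : F) := lift_op1 quot_alg ( *:%R c).

Lemma pi_quot_algM : {morph pi : x y / x * y >-> quot_alg_mul x y}.
Proof.
move=> x y; rewrite /quot_alg_mul; unlock; apply/esym/quot_algP.
rewrite -[_ * repr _](subrK (x * repr (pi y))) -mulrBl -addrA -mulrBr.
apply: rpredD; [apply: ideal2_mulr | apply: ideal2_mull];
  exact: repr_pi_quot_alg.
Qed.

Lemma pi_quot_algZ c : {morph pi : x / c *: x >-> quot_alg_scale c x}.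
Proof.
move=> x; rewrite /quot_alg_scale; unlock; apply/esym/quot_algP.
rewrite -scalerBr -mulr_algl.
exact/ideal2_mull/repr_pi_quot_alg.
Qed.

Let piE := (=^~ pi_quot_algM, =^~ pi_quot_algZ, =^~ pi_quot_algD).

Lemma quot_alg_mulA : associative quot_alg_mul.
Proof.
by move=> x y z; rewrite -[x]reprK -[y]reprK -[z]reprK !piE mulrA.
Qed.

Lemma quot_alg_mul1 : left_id quot_alg_one quot_alg_mul.
Proof. by move=> x; rewrite -[x]reprK !piE mul1r. Qed.

Lemma quot_alg_1mul : right_id quot_alg_one quot_alg_mul.
Proof. by move=> x; rewrite -[x]reprK !piE mulr1. Qed.

Lemma quot_alg_mulDl : left_distributive quot_alg_mul +%R.
Proof.
by move=> x y z; rewrite -[x]reprK -[y]reprK -[z]reprK !piE mulrDl.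
Qed.

Lemma quot_alg_mulDr : right_distributive quot_alg_mul +%R.
Proof.
by move=> x y z; rewrite -[x]reprK -[y]reprK -[z]reprK !piE mulrDr.
Qed.

Lemma quot_alg_oner_neq0 : quot_alg_one != 0.
Proof.
apply/eqP=> E; have: pi 1 = pi 0.
  by rewrite -/quot_alg_one E; exact/esym/(@pi_zeror _ _ _ _ _ (Quotient.quot (ideal2_pred I))).
by move/quot_algP; rewrite subr0; apply/negP/ideal2_proper.
Qed.

HB.instance Definition _ := GRing.Zmodule_isNzRing.Build quot_alg
  quot_alg_mulA quot_alg_mul1 quot_alg_1mul quot_alg_mulDl quot_alg_mulDr
  quot_alg_oner_neq0.

Lemma quot_alg_scalerA a b x :
  quot_alg_scale a (quot_alg_scale b x) = quot_alg_scale (a * b) x.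
Proof. by rewrite -[x]reprK !piE scalerA. Qed.

Lemma quot_alg_scale1r : left_id 1 quot_alg_scale.
Proof. by move=> x; rewrite -[x]reprK !piE scale1r. Qed.

Lemma quot_alg_scalerDr : right_distributive quot_alg_scale +%R.
Proof. by move=> c x y; rewrite -[x]reprK -[y]reprK !piE scalerDr. Qed.

Lemma quot_alg_scalerDl x : {morph quot_alg_scale^~ x : a b / a + b}.
Proof. by move=> a b; rewrite -[x]reprK !piE scalerDl. Qed.

HB.instance Definition _ := GRing.Zmodule_isLmodule.Build F quot_alg
  quot_alg_scalerA quot_alg_scale1r quot_alg_scalerDr quot_alg_scalerDl.

Lemma quot_alg_scalerAl (c : F) (x y : quot_alg) :
  c *: (x * y) = (c *: x) * y.
Proof.
change (quot_alg_scale c (quot_alg_mul x y)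
        = quot_alg_mul (quot_alg_scale c x) y).
by rewrite -[x]reprK -[y]reprK !piE scalerAl.
Qed.

HB.instance Definition _ :=
  GRing.Lmodule_isLalgebra.Build F quot_alg quot_alg_scalerAl.

Lemma quot_alg_scalerAr (c : F) (x y : quot_alg) :
  c *: (x * y) = x * (c *: y).
Proof.
change (quot_alg_scale c (quot_alg_mul x y)
        = quot_alg_mul x (quot_alg_scale c y)).
by rewrite -[x]reprK -[y]reprK !piE scalerAr.
Qed.

HB.instance Definition _ :=
  GRing.Lalgebra_isAlgebra.Build F quot_alg quot_alg_scalerAr.

Lemma quot_alg_pi_is_zmod_morphism : zmod_morphism pi.
Proof. exact: raddfB. Qed.

Lemma quot_alg_pi_is_monoid_morphism : monoid_morphism pi.
Proof. by split=> // x y; exact: pi_quot_algM. Qed.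

Lemma quot_alg_pi_is_scalable : scalable pi.
Proof. by move=> c x; exact: pi_quot_algZ. Qed.

Definition quot_alg_pi : B -> quot_alg := pi.

HB.instance Definition _ := GRing.isZmodMorphism.Build B quot_alg quot_alg_pi
  quot_alg_pi_is_zmod_morphism.
HB.instance Definition _ := GRing.isMonoidMorphism.Build B quot_alg quot_alg_pi
  quot_alg_pi_is_monoid_morphism.
HB.instance Definition _ := GRing.isScalable.Build F B quot_alg *:%R quot_alg_pi
  quot_alg_pi_is_scalable.

End QuotientAlgebra.

(* The noncommutative [malg] only comes with a left-algebra structure, hence
   the alias, on which the full algebra structure is declared. *)
Definition free_alg (F : fieldType) := {malg F[{fmonom 'I_2}]}.

Section FreeAlgebra.
Variable F : fieldType.

HB.instance Definition _ := GRing.Lalgebra.on (free_alg F).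

Lemma free_alg_scalerAr (k : F) (x y : free_alg F) :
  k *: (x * y) = x * (k *: y).
Proof.
suff ZC (g : free_alg F) : k *: g = g * malgC k.
  by rewrite (ZC (x * y)) (ZC y) mulrA.
rewrite /free_alg in g *; rewrite malgZ_def malgM_def fgmulgU.
by apply: eq_bigr => m _; rewrite mulm1 mulrC.
Qed.

HB.instance Definition _ :=
  GRing.Lalgebra_isAlgebra.Build F (free_alg F) free_alg_scalerAr.

Definition fa : free_alg F := << fmu 0%R >>.
Definition fb : free_alg F := << fmu 1%R >>.

End FreeAlgebra.

Section ZeroDiagonal.
Variable F : fieldType.

Definition zero_diag : {pred 'M[F]_2} :=
  fun x => (x 0 0 == 0) && (x 1 1 == 0).

Lemma zero_diag_submod_closed : submod_closed zero_diag.
Proof.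
split=> [|c x y]; first by rewrite unfold_in !mxE !eqxx.
rewrite !unfold_in !mxE => /andP[/eqP-> /eqP->] /andP[/eqP-> /eqP->].
by rewrite mulr0 addr0 eqxx.
Qed.

HB.instance Definition _ :=
  GRing.isSubmodClosed.Build F 'M[F]_2 zero_diag zero_diag_submod_closed.

(* The space A. *)
Record zdmat := ZDmat { zdmat_val :> 'M[F]_2; zdmat_valP : zdmat_val \in zero_diag }.

HB.instance Definition _ := [isSub for zdmat_val].
HB.instance Definition _ := [Choice of zdmat by <:].
HB.instance Definition _ := [SubChoice_isSubLmodule of zdmat by <:].

Lemma zero_diag_mul3 (x y z : 'M[F]_2) :
  x \in zero_diag -> y \in zero_diag -> z \in zero_diag ->
  x * y * z \in zero_diag.
Proof.
rewrite !unfold_in => /andP[/eqP x0 /eqP x1] /andP[/eqP y0 /eqP y1].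
move=> /andP[/eqP z0 /eqP z1].
have E i j (s t : 'M[F]_2) : (s * t) i j = s i 0 * t 0 j + s i 1 * t 1 j.
  by rewrite mxE big_ord_recl big_ord1; congr (_ + s i _ * t _ j); apply/val_inj.
by rewrite !E x0 x1 y0 y1 z0 z1 !(mul0r, mulr0, addr0, add0r) !eqxx.
Qed.

Lemma symsum_zero_diag (x y z : zdmat) : symsum (x : 'M[F]_2) y z \in zero_diag.
Proof.
have H (u v w : zdmat) : (u : 'M[F]_2) * circ (v : 'M[F]_2) w \in zero_diag.
  rewrite /circ -scalerAr mulrDr !mulrA rpredZ ?rpredD //;
    by apply: zero_diag_mul3; apply: zdmat_valP.
by rewrite /symsum !rpredD ?H.
Qed.

Definition zdsymsum (x y z : zdmat) : zdmat := ZDmat (symsum_zero_diag x y z).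

Lemma e1_subproof : delta_mx 0 1 \in zero_diag.
Proof. by rewrite unfold_in !mxE !eqxx. Qed.

Lemma e2_subproof : delta_mx 1 0 \in zero_diag.
Proof. by rewrite unfold_in !mxE !eqxx. Qed.

Definition e1 : zdmat := ZDmat e1_subproof.
Definition e2 : zdmat := ZDmat e2_subproof.

Definition phi (x : zdmat) : free_alg F :=
  (x : 'M[F]_2) 0 1 *: fa F + (x : 'M[F]_2) 1 0 *: fb F.

Lemma phi_is_linear : linear phi.
Proof.
move=> c x y; rewrite /phi /= !mxE; move: (fa F) (fb F) => a b.
by rewrite !scalerDl -!scalerA scalerDr; exact: addrACA.
Qed.

HB.instance Definition _ :=
  GRing.isLinear.Build F zdmat (free_alg F) *:%R phi phi_is_linear.

Lemma phi_e1 : phi e1 = fa F.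
Proof. by rewrite /phi /= !mxE !eqxx /= scale1r scale0r addr0. Qed.

Lemma phi_e2 : phi e2 = fb F.
Proof. by rewrite /phi /= !mxE !eqxx /= scale1r scale0r add0r. Qed.

Inductive relator : free_alg F -> Prop :=
| Relator (x y z : zdmat) of x \in [:: e1; e2] & y \in [:: e1; e2]
    & z \in [:: e1; e2] :
    relator (symsum (phi x) (phi y) (phi z) - phi (zdsymsum x y z)).

End ZeroDiagonal.

Section Envelope.
Variable F : fieldType.

Definition env_rel : {pred free_alg F} :=
  fun p => `[< ideal_gen (@relator F) p >].

Lemma env_relP p : reflect (ideal_gen (@relator F) p) (p \in env_rel).
Proof. exact: asboolP. Qed.

Lemma env_rel_mull c p : p \in env_rel -> c * p \in env_rel.
Proof. by move/env_relP=> ?; apply/env_relP/IdealMulL. Qed.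

Lemma env_rel_mulr c p : p \in env_rel -> p * c \in env_rel.
Proof. by move/env_relP=> ?; apply/env_relP/IdealMulR. Qed.

Lemma env_rel_zmod_closed : zmod_closed env_rel.
Proof.
split=> [|p q /env_relP Ip Iq]; first exact/env_relP/IdealZero.
apply/env_relP/IdealAdd=> //; rewrite -mulN1r.
exact/env_relP/env_rel_mull.
Qed.

(* The inclusion of A into the 2 x 2 matrices extends to the envelope, which is
   therefore nonzero. *)
Definition word_mx (w : {fmonom 'I_2}) : 'M[F]_2 :=
  \prod_(i <- (w : seq 'I_2)) zdmat_val (if i == 0 then e1 F else e2 F).

Lemma word_mx_is_multiplicative : monalg.mmorphism word_mx.
Proof.
by split=> [v w|]; rewrite /word_mx ?fmM ?fm1 ?big_nil // big_cat.
Qed.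

HB.instance Definition _ := monalg.isMultiplicative.Build {fmonom 'I_2} 'M[F]_2
  word_mx word_mx_is_multiplicative.

Definition free_mx : free_alg F -> 'M[F]_2 := mmap (@scalar_mx F 2) word_mx.

Lemma free_mx_multiplicative : multiplicative free_mx.
Proof.
by apply: commr_mmap_is_multiplicative => g m m'; exact: (esym (scalar_mxC _ _)).
Qed.

Lemma free_mxB : {morph free_mx : p q / p - q}.
Proof. exact: (mmapB (f := @scalar_mx F 2)). Qed.

Lemma free_mxM : {morph free_mx : p q / p * q}.
Proof. by case: free_mx_multiplicative. Qed.

Lemma free_mx1 : free_mx 1 = 1.
Proof. by case: free_mx_multiplicative. Qed.

Lemma free_mxD : {morph free_mx : p q / p + q}.
Proof. exact: (mmapD (f := @scalar_mx F 2)). Qed.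

Lemma free_mxZ c : {morph free_mx : p / c *: p}.
Proof.
move=> p; rewrite -mul_scalar_mx.
exact: (@mmapZ _ _ _ (@scalar_mx F 2) (@word_mx)).
Qed.

Lemma free_mx_fa : free_mx (fa F) = e1 F.
Proof.
rewrite /free_mx /fa (mmapU (f := @scalar_mx F 2)) mul1r /word_mx fmU.
by rewrite big_seq1.
Qed.

Lemma free_mx_fb : free_mx (fb F) = e2 F.
Proof.
rewrite /free_mx /fb (mmapU (f := @scalar_mx F 2)) mul1r /word_mx fmU.
by rewrite big_seq1.
Qed.

Lemma free_mx_phi x : free_mx (phi x) = x.
Proof.
transitivity ((x : 'M[F]_2) 0 1 *: free_mx (fa F)
              + (x : 'M[F]_2) 1 0 *: free_mx (fb F)).
  rewrite /phi free_mxD; congr (_ + _); exact: free_mxZ.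
rewrite free_mx_fa free_mx_fb; case: x => x /=.
rewrite unfold_in => /andP[/eqP x0 /eqP x1].
apply/matrixP=> i j; rewrite !mxE.
case: i => [[|[|//]] ilt]; case: j => [[|[|//]] jlt]; rewrite !eqE /=.
- by rewrite !mulr0 addr0 -{}x0; congr (x _ _); apply/val_inj.
- by rewrite mulr1 mulr0 addr0; congr (x _ _); apply/val_inj.
- by rewrite mulr1 mulr0 add0r; congr (x _ _); apply/val_inj.
- by rewrite !mulr0 addr0 -{}x1; congr (x _ _); apply/val_inj.
Qed.

Lemma free_mx_symsum p q r :
  free_mx (symsum p q r) = symsum (free_mx p) (free_mx q) (free_mx r).
Proof.
have C u v : free_mx (circ u v) = circ (free_mx u) (free_mx v).
  rewrite /circ; transitivity (2^-1 *: free_mx (u * v + v * u)).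
    exact: free_mxZ.
  by congr (_ *: _); rewrite free_mxD; congr (_ + _); exact: free_mxM.
have MC u v w : free_mx (u * circ v w) = free_mx u * circ (free_mx v) (free_mx w).
  by rewrite -C; exact: free_mxM.
rewrite /symsum free_mxD; congr (_ + _); last exact: MC.
by rewrite free_mxD; congr (_ + _); exact: MC.
Qed.

Lemma env_rel1 : 1 \notin env_rel.
Proof.
apply/negP=> /env_relP I1.
suff H p : ideal_gen (@relator F) p -> free_mx p = 0.
  by have /eqP := H _ I1; rewrite free_mx1 oner_eq0.
elim=> {p I1} [_ [x y z _ _ _]||x y _ x0 _ y0|c x _ x0|c x _ x0].
- rewrite free_mxB; apply/eqP; rewrite subr_eq0; apply/eqP.
  transitivity (zdsymsum x y z : 'M[F]_2); last exact/esym/free_mx_phi.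
  by rewrite free_mx_symsum; congr symsum; exact: free_mx_phi.
- exact: (mmap0 (f := @scalar_mx F 2)).
- by rewrite free_mxD x0 y0 addr0.
- by rewrite free_mxM x0 mulr0.
- by rewrite free_mxM x0 mul0r.
Qed.

Definition env_ideal : ideal2 (free_alg F) :=
  Ideal2 env_rel_zmod_closed env_rel_mull env_rel_mulr env_rel1.

Definition env := quot_alg env_ideal.

HB.instance Definition _ := GRing.Algebra.on env.

Definition env_pi : free_alg F -> env := @quot_alg_pi F (free_alg F) env_ideal.
HB.instance Definition _ := GRing.LRMorphism.on env_pi.

Definition ea : env := env_pi (fa F).
Definition eb : env := env_pi (fb F).

End Envelope.

Definition gamma1 (m : nat) : int := if odd m then - (m%:Z - 3) else m%:Z + 1.
Definition gamma2 (m : nat) : int := if odd m then -1 else -3.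
Definition gamma3 (m : nat) : int := if odd m then -2 else 0.
Definition gamma4 (m : nat) : int := if odd m then m%:Z else - m%:Z + 2.

Definition deltahat (m : nat) : int := if m == 2 then 0 else 1.

Definition calZ (F : fieldType) (m : nat) : env F :=
  let a := ea F in let b := eb F in
  (\sum_(1 <= j < m.-1)
      ((-1) ^+ j.+1 * 'C(m - 1, j - 1)%:R : F)
        *: ((b * a) ^+ j - a * (b * a) ^+ (j - 1) * b)) *~ deltahat m
  + ((b * a) ^+ (m - 1)) *~ gamma1 m
  + ((b * a) ^+ m) *~ gamma2 m
  + (a * (b * a) ^+ (m - 1) * b) *~ gamma3 m
  + (a * (b * a) ^+ (m - 2) * b) *~ gamma4 m
  + (a ^+ 2 * (b * a) ^+ (m - 2) * b ^+ 2) *+ 3.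

(* Main.v *)
Require Import Defs.
From mathcomp Require Import all_boot all_algebra.
From HB Require Import structures.
From mathcomp Require Import ring monalg.

(* Put p = ab, q = ba and r = 1 - p - q. The relations of U say that a^3 = b^3 = 0
   and that p, q, r commute and are permuted cyclically when a or b moves past
   them: a q = p a, a p = r a, a r = q a. Moreover p q r = 0, so the degree 0 part
   of U is the coordinate ring of the triangle p q r = 0 in the plane
   p + q + r = 1. The elements a^i h(q) b^k with i, k < 3 span U, and the
   representation of U on F[t]^3 in which a is the lower shift and b has
   superdiagonal (t, 1 - t) separates them, hence is faithful. A matrix commuting
   with the images of a and b is a scalar g(t), and the scalars in the image are
   those with g(0) = g(1). Finally Z(m) acts as
   t (1 - t) ((1 - t)^(m-2) + 2 t^(m-2)), of degree m in t, so the Z(m) together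
   with 1 span all these scalars. *)

Set Implicit Arguments.
Unset Strict Implicit.
Unset Printing Implicit Defensive.

Import GRing.Theory.
Local Open Scope ring_scope.

(** * Moving algebra elements past polynomials *)

Section HornerAlg.
Variables (F : fieldType) (B : algType F).
Implicit Types (x y z : B) (h k : {poly F}).

(** Besides carrying a and b past polynomials in p, q, r, this is applied to elements such as
    [p * q], where [y] and [z] agree only on the side of the triangle that supports [x]. *)
Lemma horner_alg_intertwine x y z h :
  x * y = z * x -> x * horner_alg y h = horner_alg z h * x.
Proof.
move=> xyE; elim/poly_ind: h => [|h c IH]; first by rewrite !rmorph0 mulr0 mul0r.
rewrite !rmorphD !rmorphM /= !horner_algX !horner_algC mulrDr mulrDl mulrA IH.
by rewrite -!mulrA xyE mulr_algl mulr_algr.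
Qed.

Lemma horner_alg_comm x y h :
  x * y = y * x -> x * horner_alg y h = horner_alg y h * x.
Proof. exact: horner_alg_intertwine. Qed.

Lemma horner_alg_comp x h k :
  horner_alg x (h \Po k) = horner_alg (horner_alg x k) h.
Proof.
elim/poly_ind: h => [|h c IH]; first by rewrite comp_poly0 !rmorph0.
rewrite comp_polyD comp_polyM comp_polyX comp_polyC !rmorphD !rmorphM /=.
by rewrite IH !horner_algC horner_algX.
Qed.

End HornerAlg.

(** * Spanning by a^i h(ba) b^k *)

Section NormalForm.
Variables (F : fieldType) (B : algType F) (a b : B).
Hypotheses (a3 : a ^+ 3 = 0) (b3 : b ^+ 3 = 0).
Hypothesis aabE : a ^+ 2 * b + a * b * a + b * a ^+ 2 = a.
Hypothesis abbE : a * b ^+ 2 + b * a * b + b ^+ 2 * a = b.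
Variables p q r : B.
Hypotheses (pE : a * b = p) (qE : b * a = q) (rE : r = 1 - p - q).

Local Notation ev := (@horner_alg F B).

(** * Commutation rules for p, q and r *)

Lemma aqE : a * q = p * a. Proof. by rewrite -pE -qE mulrA. Qed.

(** Subtracting aba = pa and ba^2 = qa from the relation [aabE] leaves a^2 b. *)
Lemma apE : a * p = r * a.
Proof.
rewrite rE !mulrBl mul1r -[X in _ = X - _ - _]aabE -pE -qE.
by rewrite !expr2 !mulrA addrAC !addrK.
Qed.

Lemma bqE : b * q = r * b.
Proof.
rewrite rE !mulrBl mul1r -[X in _ = X - _ - _]abbE -pE -qE !expr2 !mulrA.
by rewrite -[X in _ = X]addrA -opprD addrAC subrr add0r.
Qed.

Lemma arE : a * r = q * a.
Proof.
rewrite rE !mulrBr mulr1 aqE apE rE !mulrBl mul1r.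
by rewrite opprB addrCA opprB [a + _]addrC subrK addrK.
Qed.

(** Passing b turns q into r and passing a turns r back into q, so q crosses p = ab unchanged. *)
Lemma pqC : p * q = q * p.
Proof. by rewrite -{1}pE -mulrA bqE mulrA arE -mulrA pE. Qed.

Lemma prC : p * r = r * p.
Proof. by rewrite rE !(mulrBr, mulrBl) mulr1 mul1r pqC. Qed.

Lemma qrC : q * r = r * q.
Proof. by rewrite rE !(mulrBr, mulrBl) mulr1 mul1r pqC. Qed.

(** Carrying each ab to the left gives a^3 b^3 = a^2 p b^2 = q a p b = q r p. *)
Lemma qrp0 : q * r * p = 0.
Proof.
have: a ^+ 3 * b ^+ 3 = 0 by rewrite a3 mul0r.
rewrite !exprS !expr0 !mulr1 -!mulrA (mulrA a b) pE (mulrA a p) apE.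
rewrite -(mulrA r) (mulrA a r) arE (mulrA a b) pE -mulrA (mulrA a p) apE.
by rewrite -mulrA pE.
Qed.

Lemma rpq0 : r * p * q = 0.
Proof. by rewrite -(mulrA r) pqC (mulrA r) -qrC qrp0. Qed.

Lemma onem_p : 1 - p = q + r.
Proof. by rewrite rE [RHS]addrC subrK. Qed.

(** The product pq is supported on the side r = 0, where q = 1 - p. The next two lemmas treat rp in
    the same way on the side q = 0, where p + r = 1. *)
Lemma pqq : p * q * q = (1 - p) * (p * q).
Proof. by rewrite onem_p mulrDl (mulrA r p) rpq0 addr0 (mulrA q p) pqC. Qed.

Lemma rpr : r * p * r = (1 - p) * (r * p).
Proof. by rewrite onem_p mulrDl (mulrA q r) qrp0 add0r -(mulrA r) prC. Qed.

Lemma prp : p * (r * p) = (1 - r) * (r * p).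
Proof.
have -> : 1 - r = p + q by rewrite rE -addrA -opprD opprB addrC subrK.
by rewrite mulrDl (mulrA q) qrp0 addr0.
Qed.

Lemma aevb h : a * ev q h * b = ev p h * p.
Proof. by rewrite (horner_alg_intertwine _ aqE) -mulrA pE. Qed.

Lemma aevb2 h : a ^+ 2 * ev q h * b ^+ 2 = ev r h * (r * p).
Proof.
transitivity (a * (a * ev q h * b) * b); first by rewrite !expr2 !mulrA.
rewrite aevb (mulrA a) (horner_alg_intertwine _ apE) -(mulrA _ a).
by rewrite apE -!mulrA pE.
Qed.

(* The three summands are [h0(q)], [h1(p) p] and [h2(r) r p], supported on the
   whole triangle, off the side [p = 0], and on the side [q = 0]. *)
Definition normal0 (w : B) : Prop := exists h0 h1 h2 : {poly F},
  w = ev q h0 + a * ev q h1 * b + a ^+ 2 * ev q h2 * b ^+ 2.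

Lemma normal0D v w : normal0 v -> normal0 w -> normal0 (v + w).
Proof.
move=> [h0 [h1 [h2 ->]]] [k0 [k1 [k2 ->]]].
exists (h0 + k0), (h1 + k1), (h2 + k2).
by rewrite !rmorphD /= !(mulrDl, mulrDr) addrACA; congr (_ + _); rewrite addrACA.
Qed.

Lemma normal0_q h : normal0 (ev q h).
Proof. by exists h, 0, 0; rewrite !rmorph0 !mulr0 !mul0r !addr0. Qed.

Lemma normal0_p h : normal0 (ev p h * p).
Proof. by exists 0, h, 0; rewrite !rmorph0 !mulr0 !mul0r addr0 add0r aevb. Qed.

Lemma normal0_rp h : normal0 (ev r h * (r * p)).
Proof. by exists 0, 0, h; rewrite !rmorph0 !mulr0 !mul0r !add0r aevb2. Qed.

Lemma normal0P w : normal0 w <-> exists h0 h1 h2 : {poly F},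
  w = ev q h0 + ev p h1 * p + ev r h2 * (r * p).
Proof.
by split=> -[h0 [h1 [h2 ->]]]; exists h0, h1, h2; rewrite aevb aevb2.
Qed.

(** On the side r = 0 the factor h(q) becomes h(1 - p). Splitting pq = (1 - p) p - rp then yields a
    summand in p alone and one on the side q = 0, where 1 - p is r again. *)
Lemma pq_ev h : p * q * ev q h =
  ev p ((1 - 'X) * (h \Po (1 - 'X))) * p - ev r h * (r * p).
Proof.
rewrite (horner_alg_intertwine _ pqq).
have -> : p * q = (1 - p) * p - r * p by rewrite onem_p mulrDl addrK pqC.
rewrite mulrBr -(horner_alg_intertwine _ rpr).
have rprC : r * p * r = r * (r * p) by rewrite -(mulrA r) prC.
rewrite (horner_alg_comm _ rprC); congr (_ - _).
have ev1 : ev p (1 - 'X) = 1 - p by rewrite rmorphB rmorph1 /= horner_algX.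
by rewrite mulrC rmorphM /= horner_alg_comp ev1 mulrA.
Qed.

Lemma normal0_mulp w : normal0 w -> normal0 (p * w).
Proof.
move/normal0P=> [h0 [h1 [h2 ->]]]; rewrite !mulrDr; do ![apply: normal0D].
(* The induction principle serves as division of h0 by 'X: the multiple of q is handled by [pq_ev],
   and the constant gives a multiple of p. *)
- elim/poly_ind: h0 => [|h c _].
    by rewrite rmorph0 mulr0; have := normal0_q 0; rewrite rmorph0.
  rewrite rmorphD rmorphM /= horner_algX horner_algC mulrDr; apply: normal0D.
    rewrite -(horner_alg_comm h (erefl (q * q))) mulrA pq_ev.
    apply: normal0D; first exact: normal0_p.
    by rewrite -mulNr -rmorphN; apply: normal0_rp.
  by rewrite mulr_algr -mulr_algl -(horner_algC p); apply: normal0_p.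
- by rewrite mulrA -{1}(horner_algX p) -rmorphM; apply: normal0_p.
have -> : p * (ev r h2 * (r * p)) = ev r (h2 * (1 - 'X)) * (r * p).
  rewrite mulrA (horner_alg_comm _ prC) -mulrA prp rmorphM rmorphB rmorph1 /=.
  by rewrite horner_algX mulrA.
exact: normal0_rp.
Qed.

Lemma normal0_mulZ c w : normal0 w -> normal0 (c *: w).
Proof.
move=> [h0 [h1 [h2 ->]]]; exists (c *: h0), (c *: h1), (c *: h2).
by rewrite !linearZ /= !mulr_algl !scalerDr -!scalerAr -!scalerAl.
Qed.

Lemma normal0_mulev x : (forall w, normal0 w -> normal0 (x * w)) ->
  forall h w, normal0 w -> normal0 (ev x h * w).
Proof.
move=> xW; elim/poly_ind=> [|h c IH] w Ww.
  by rewrite rmorph0 mul0r; have := normal0_q 0; rewrite rmorph0.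
rewrite rmorphD rmorphM /= horner_algX horner_algC mulrDl mulr_algl -mulrA.
by apply: normal0D; [apply/IH/xW | apply: normal0_mulZ].
Qed.

(** The first summand absorbs q, the second reduces to multiplications by p applied to q, and the
    third dies because q r p = 0. *)
Lemma normal0_mulq w : normal0 w -> normal0 (q * w).
Proof.
move/normal0P=> [h0 [h1 [h2 ->]]]; rewrite !mulrDr; do ![apply: normal0D].
- by rewrite -{1}(horner_algX q) -rmorphM; apply: normal0_q.
- rewrite mulrA (horner_alg_comm _ (esym pqC)) -mulrA -pqC.
  apply: normal0_mulev; first exact: normal0_mulp.
  by apply: normal0_mulp; rewrite -(horner_algX q); apply: normal0_q.
- rewrite mulrA (horner_alg_comm _ qrC) -mulrA (mulrA q) qrp0 mulr0.
  by have := normal0_q 0; rewrite rmorph0.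
Qed.

Lemma normal0_mulr w : normal0 w -> normal0 (r * w).
Proof.
have WN v : normal0 v -> normal0 (- v) by rewrite -scaleN1r; apply: normal0_mulZ.
move=> Ww; rewrite rE !mulrBl mul1r.
by do ![apply: normal0D] => //; apply: WN;
  [apply: normal0_mulp | apply: normal0_mulq].
Qed.

Lemma normal0_evr h : normal0 (ev r h).
Proof.
rewrite -[ev r h]mulr1; apply: normal0_mulev normal0_mulr _ _ _.
by have := normal0_q 1; rewrite rmorph1.
Qed.

(** * Normal forms in all degrees *)

Definition normal (u : B) : Prop := exists h : nat -> nat -> {poly F},
  u = \sum_(i < 3) \sum_(k < 3) a ^+ i * ev q (h i k) * b ^+ k.

(** The exponents are unbounded on purpose: those above 2 give 0, so later products can raise
    exponents freely. *)
Lemma normal_monom i k h : normal (a ^+ i * ev q h * b ^+ k).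
Proof.
have [i3|i3] := ltnP i 3; last first.
  exists (fun _ _ => 0); rewrite -(subnK i3) exprD a3 mulr0 !mul0r.
  by rewrite big1 // => ? _; rewrite big1 // => ? _; rewrite rmorph0 mulr0 mul0r.
have [k3|k3] := ltnP k 3; last first.
  exists (fun _ _ => 0); rewrite -(subnKC k3) exprD b3 mul0r !mulr0.
  by rewrite big1 // => ? _; rewrite big1 // => ? _; rewrite rmorph0 mulr0 mul0r.
exists (fun i' k' => if (i' == i) && (k' == k) then h else 0).
rewrite (bigD1 (Ordinal i3)) //= (bigD1 (Ordinal k3)) //= !eqxx /=.
rewrite big1 ?addr0 => [|k' k'k]; last first.
  by rewrite -val_eqE /= in k'k; rewrite (negbTE k'k) rmorph0 mulr0 mul0r.
rewrite big1 ?addr0 // => i' i'i; rewrite big1 // => k' _.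
by rewrite -val_eqE /= in i'i; rewrite (negbTE i'i) rmorph0 mulr0 mul0r.
Qed.

Lemma normalD u v : normal u -> normal v -> normal (u + v).
Proof.
move=> [h ->] [k ->]; exists (fun i j => h i j + k i j).
rewrite -big_split; apply: eq_bigr => i _; rewrite -big_split.
by apply: eq_bigr => j _; rewrite rmorphD mulrDr mulrDl.
Qed.

Lemma normalZ c u : normal u -> normal (c *: u).
Proof.
move=> [h ->]; exists (fun i j => c *: h i j).
rewrite scaler_sumr; apply: eq_bigr => i _; rewrite scaler_sumr.
by apply: eq_bigr => j _; rewrite linearZ /= mulr_algl -scalerAr -scalerAl.
Qed.

Lemma normal_sum n (u : 'I_n -> B) :
  (forall i, normal (u i)) -> normal (\sum_i u i).
Proof.
move=> uN; elim/big_ind: _ => //; last exact: normalD.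
by have := normal_monom 0 0 0; rewrite rmorph0 mulr0 mul0r.
Qed.

(** The three summands of [w] raise both exponents by 0, 1 and 2. *)
Lemma normal_normal0 i k w : normal0 w -> normal (a ^+ i * w * b ^+ k).
Proof.
move=> [h0 [h1 [h2 ->]]]; rewrite !(mulrDr, mulrDl).
do ![apply: normalD]; first exact: normal_monom.
  rewrite !mulrA -exprSr -[_ * b * _]mulrA -exprS; exact: normal_monom.
rewrite 2!(mulrA (a ^+ i)) -exprD -(mulrA _ (b ^+ 2)) -exprD.
exact: normal_monom.
Qed.

Lemma normal_mula u : normal u -> normal (a * u).
Proof.
move=> [h ->]; rewrite mulr_sumr; apply: normal_sum => i.
rewrite mulr_sumr; apply: normal_sum => k.
by rewrite !mulrA -exprS; exact: normal_monom.
Qed.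

(** For i = 0, b moves past h(q), leaving h(r); for i = 1, ba = q is absorbed; for i = 2, ba^2 = qa
    = ar, and r multiplies a degree 0 normal form. *)
Lemma normal_mulb u : normal u -> normal (b * u).
Proof.
move=> [h ->]; rewrite mulr_sumr; apply: normal_sum => i.
rewrite mulr_sumr; apply: normal_sum => k; move: (h i k) => {}h.
case: i => [[|[|[|//]]] ilt] /=.
- rewrite expr0 mul1r mulrA (horner_alg_intertwine h bqE) -mulrA -exprS.
  by rewrite -[ev r h]mul1r -(expr0 a); apply/normal_normal0/normal0_evr.
- rewrite expr1 !mulrA qE -{1}(horner_algX q) -rmorphM /= -[ev q _]mul1r -(expr0 a).
  exact: normal_monom.
- rewrite expr2 !mulrA qE -arE -(mulrA a) -(expr1 a).
  by apply/normal_normal0/normal0_mulr/normal0_q.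
Qed.

(** Induction on products works for the stronger claim that left multiplication by [u] preserves
    normal elements; it is then applied to 1. *)
Lemma subalg_gen_normal u :
  subalg_gen (fun x => x = a \/ x = b) u -> normal u.
Proof.
suff H v : subalg_gen (fun x => x = a \/ x = b) v ->
    forall w, normal w -> normal (v * w).
  move=> Gu; rewrite -[u]mulr1; apply: H => //.
  by have := normal_monom 0 0 1; rewrite rmorph1 !mul1r.
elim=> {v} [x [] ->|w //|c x _ IH w Nw|x y _ IHx _ IHy w Nw|x y _ IHx _ IHy w Nw].
- exact: normal_mula.
- exact: normal_mulb.
- by rewrite mul1r.
- by rewrite -scalerAl; apply/normalZ/IH.
- by rewrite mulrDl; apply: normalD; [apply: IHx | apply: IHy].
- by rewrite -mulrA; apply/IHx/IHy.
Qed.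
End NormalForm.

(** * The representation by 3 x 3 matrices *)

Section Matrix3.
Variable R : comNzRingType.
Implicit Types f g : nat -> nat -> R.

(** Entries indexed by natural numbers reduce matrix equalities to nine ring identities by case
    analysis. *)
Definition mx3 f : 'M[R]_3 := \matrix_(i < 3, j < 3) f i j.

Lemma eq_mx3 f g :
  (forall i j, (i < 3)%N -> (j < 3)%N -> f i j = g i j) -> mx3 f = mx3 g.
Proof. by move=> fg; apply/matrixP=> i j; rewrite !mxE fg. Qed.

Lemma mx3_inj f g :
  mx3 f = mx3 g -> forall i j, (i < 3)%N -> (j < 3)%N -> f i j = g i j.
Proof.
move=> fg i j i3 j3.
by have := congr1 (fun M : 'M[R]_3 => M (Ordinal i3) (Ordinal j3)) fg; rewrite !mxE.
Qed.

Lemma mx3_eq0 f i j : mx3 f = 0 -> (i < 3)%N -> (j < 3)%N -> f i j = 0.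
Proof.
move=> f0 i3 j3.
by have := congr1 (fun M : 'M[R]_3 => M (Ordinal i3) (Ordinal j3)) f0; rewrite !mxE.
Qed.

Lemma mx3D f g : mx3 f + mx3 g = mx3 (fun i j => f i j + g i j).
Proof. by apply/matrixP=> i j; rewrite !mxE. Qed.

Lemma mx3Z c f : c *: mx3 f = mx3 (fun i j => c * f i j).
Proof. by apply/matrixP=> i j; rewrite !mxE. Qed.

Lemma mx3M f g :
  mx3 f * mx3 g = mx3 (fun i j => f i 0 * g 0 j + f i 1 * g 1 j + f i 2 * g 2 j).
Proof.
by apply/matrixP=> i j; rewrite !mxE !big_ord_recl big_ord0 addr0 !mxE addrA.
Qed.

Lemma mx3E (M : 'M[R]_3) : M = mx3 (fun i j => M (inord i) (inord j)).
Proof. by apply/matrixP=> i j; rewrite !mxE !inord_val. Qed.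

Definition diag3 (x y z : R) : 'M[R]_3 :=
  mx3 (fun i j => if i == j then nth 0 [:: x; y; z] i else 0).

Lemma diag3D x y z x' y' z' :
  diag3 x y z + diag3 x' y' z' = diag3 (x + x') (y + y') (z + z').
Proof.
by rewrite mx3D; apply: eq_mx3 => -[|[|[|//]]] [|[|[|//]]] _ _ /=; ring.
Qed.

Lemma diag3M x y z x' y' z' :
  diag3 x y z * diag3 x' y' z' = diag3 (x * x') (y * y') (z * z').
Proof.
by rewrite mx3M; apply: eq_mx3 => -[|[|[|//]]] [|[|[|//]]] _ _ /=; ring.
Qed.

Lemma diag3Z c x y z : c *: diag3 x y z = diag3 (c * x) (c * y) (c * z).
Proof.
by rewrite mx3Z; apply: eq_mx3 => -[|[|[|//]]] [|[|[|//]]] _ _ /=; ring.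
Qed.

Lemma diag3_scalar x : diag3 x x x = x%:M.
Proof. by apply/matrixP=> -[[|[|[|//]]] i3] [[|[|[|//]]] j3]; rewrite !mxE. Qed.

Lemma diag3X (x y z : R) n :
  diag3 x y z ^+ n = diag3 (x ^+ n) (y ^+ n) (z ^+ n).
Proof.
elim: n => [|n IH]; last by rewrite !exprS IH diag3M.
by rewrite !expr0 diag3_scalar.
Qed.

Lemma diag3Mz (x y z : R) (c : int) :
  diag3 x y z *~ c = diag3 (c%:~R * x) (c%:~R * y) (c%:~R * z).
Proof. by rewrite -diag3Z scaler_int. Qed.

Lemma diag3_sum (I : Type) (s : seq I) (f g h : I -> R) :
  \sum_(i <- s) diag3 (f i) (g i) (h i) =
  diag3 (\sum_(i <- s) f i) (\sum_(i <- s) g i) (\sum_(i <- s) h i).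
Proof.
elim: s => [|i s IH]; last by rewrite !big_cons IH diag3D.
by rewrite !big_nil diag3_scalar raddf0.
Qed.

End Matrix3.

(** * Binomial identities behind the coefficients of Z(m) *)

Section Identity.
Variable R : comNzRingType.

(* The sum in Z(n + 2), divided by [x]. *)
Definition truncated_binomial n (x : R) : R :=
  \sum_(i < n) (-1) ^+ i * 'C(n.+1, i)%:R * x ^+ i.

(** This is the binomial expansion without its last two terms. *)
Lemma truncated_binomialE n (x : R) : truncated_binomial n x =
  (1 - x) ^+ n.+1 - n.+1%:R * (- x) ^+ n - (- x) ^+ n.+1.
Proof.
rewrite exprBn !big_ord_recr /= !subnn subSnn binSn binn !expr1n.
rewrite (eq_bigr (fun i : 'I_n => (-1) ^+ i * 'C(n.+1, i)%:R * x ^+ i)) => [|i _].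
  rewrite -/(truncated_binomial n x) [(- x) ^+ n]exprNn [(- x) ^+ n.+1]exprNn.
  by rewrite !mulr1 mulr1n mulr_natl addrAC !addrK.
by rewrite expr1n mulr1 -mulr_natr mulrAC.
Qed.

(** Powers of -1 replace the parity cases, so that the coefficients can cancel the two terms missing
    from the truncated expansion. *)
Lemma gammaE n : [/\
  (gamma1 n.+2)%:~R = (2 : R) - (-1) ^+ n.+1 * n.+1%:R,
  (gamma2 n.+2)%:~R = - 2 + (-1) ^+ n.+1 :> R,
  (gamma3 n.+2)%:~R = - 1 + (-1) ^+ n :> R &
  (gamma4 n.+2)%:~R = 1 - (-1) ^+ n * n.+1%:R :> R].
Proof.
rewrite /gamma1 /gamma2 /gamma3 /gamma4 /= negbK !exprS -!(signr_odd _ n).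
have n2 : (n.+2%:Z)%:~R = n.+1%:R + 1 :> R by rewrite natr1 -pmulrn.
case: (odd n) => /=; rewrite !(rmorphD, rmorphN) /= ?n2; split; ring.
Qed.

Lemma truncated_binomial12 n x : truncated_binomial n x * x
    + (gamma1 n.+2)%:~R * x ^+ n.+1 + (gamma2 n.+2)%:~R * x ^+ n.+2
  = x * (1 - x) * ((1 - x) ^+ n + 2 * x ^+ n).
Proof.
have [-> -> _ _] := gammaE n; rewrite truncated_binomialE !(exprNn x).
rewrite !exprS; move: (x ^+ n) ((1 - x) ^+ n) ((-1) ^+ n) => y z s.
by ring.
Qed.

Lemma truncated_binomial34 n x : truncated_binomial n x * x
    - (gamma3 n.+2)%:~R * x ^+ n.+2 - (gamma4 n.+2)%:~R * x ^+ n.+1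
  = x * (1 - x) * ((1 - x) ^+ n - x ^+ n).
Proof.
have [_ _ -> ->] := gammaE n; rewrite truncated_binomialE !(exprNn x).
rewrite !exprS; move: (x ^+ n) ((1 - x) ^+ n) ((-1) ^+ n) => y z s.
by ring.
Qed.
End Identity.

(** * Faithfulness of the representation, and the centre of its image *)

Section Representation.
Variable F : fieldType.

Definition amx : 'M[{poly F}]_3 := mx3 (fun i j => (i == j.+1)%:R).
Definition bmx : 'M[{poly F}]_3 :=
  mx3 (fun i j => if j == i.+1 then nth 0 [:: 'X; 1 - 'X] i else 0).

(** The three diagonal positions parametrise the sides p = 0, r = 0 and q = 0 of the triangle, in
    this order; the matrix is the coordinate q on them. *)
Lemma bmx_amx : bmx * amx = diag3 'X (1 - 'X) 0.
Proof. by rewrite mx3M; apply: eq_mx3 => -[|[|[|//]]] [|[|[|//]]] _ _ /=; ring. Qed.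

Lemma amx3 : amx ^+ 3 = 0.
Proof.
rewrite !exprS expr0 mulr1 !mx3M; apply/matrixP.
by move=> -[[|[|[|//]]] i3] [[|[|[|//]]] j3]; rewrite !mxE /=; ring.
Qed.
Lemma bmx3 : bmx ^+ 3 = 0.
Proof.
rewrite !exprS expr0 mulr1 !mx3M; apply/matrixP.
by move=> -[[|[|[|//]]] i3] [[|[|[|//]]] j3]; rewrite !mxE /=; ring.
Qed.
Lemma aabmx : amx ^+ 2 * bmx + amx * bmx * amx + bmx * amx ^+ 2 = amx.
Proof.
rewrite !expr2 !(mx3M, mx3D).
by apply: eq_mx3 => -[|[|[|//]]] [|[|[|//]]] _ _ /=; ring.
Qed.
Lemma abbmx : amx * bmx ^+ 2 + bmx * amx * bmx + bmx ^+ 2 * amx = bmx.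
Proof.
rewrite !expr2 !(mx3M, mx3D).
by apply: eq_mx3 => -[|[|[|//]]] [|[|[|//]]] _ _ /=; ring.
Qed.

(** Commuting with the shift makes [M] lower triangular and constant along its diagonals. Commuting
    with [bmx] kills the entries below the diagonal, since 'X and 1 - 'X are cancellable. *)
Lemma comm_amx_bmx (M : 'M[{poly F}]_3) :
  GRing.comm M amx -> GRing.comm M bmx -> M = (M 0 0)%:M.
Proof.
rewrite [M]mx3E; set m := fun i j => M _ _ => Ma Mb.
have Ea i j := mx3_inj (etrans (esym (mx3M _ _)) (etrans Ma (mx3M _ _)))
  (i := i) (j := j).
have Eb i j := mx3_inj (etrans (esym (mx3M _ _)) (etrans Mb (mx3M _ _)))
  (i := i) (j := j).
pose sE := (mulr0, mulr1, mul0r, mul1r, addr0, add0r).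
have m01 : m 0%N 1%N = 0 by have := Ea 0%N 0%N isT isT; rewrite /= !sE.
have m02 : m 0%N 2%N = 0 by have := Ea 0%N 1%N isT isT; rewrite /= !sE.
have m12 : m 1%N 2%N = 0 by have := Ea 1%N 1%N isT isT; rewrite /= !sE m01.
have m11 : m 1%N 1%N = m 0%N 0%N by have := Ea 1%N 0%N isT isT; rewrite /= !sE.
have m22 : m 2%N 2%N = m 0%N 0%N by have := Ea 2%N 1%N isT isT; rewrite /= !sE m11.
have m21 : m 2%N 1%N = m 1%N 0%N by have := Ea 2%N 0%N isT isT; rewrite /= !sE.
have m10 : m 1%N 0%N = 0.
  have /esym/eqP := Eb 0%N 0%N isT isT.
  by rewrite /= !sE mulf_eq0 polyX_eq0 => /eqP.
have m20 : m 2%N 0%N = 0.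
  have /esym/eqP := Eb 1%N 0%N isT isT.
  by rewrite /= !sE mulf_eq0 -oppr_eq0 opprB polyXsubC_eq0 => /eqP.
have -> : mx3 m 0 0 = m 0%N 0%N by rewrite mxE.
rewrite -diag3_scalar; apply: eq_mx3 => -[|[|[|//]]] [|[|[|//]]] _ _ //=.
by rewrite m21.
Qed.

Lemma amx_diag_bmx x y z : amx * diag3 x y z * bmx = diag3 0 (x * 'X) (y * (1 - 'X)).
Proof. by rewrite !mx3M; apply: eq_mx3 => -[|[|[|//]]] [|[|[|//]]] _ _ /=; ring. Qed.

Lemma amx2_diag_bmx2 x y z :
  amx ^+ 2 * diag3 x y z * bmx ^+ 2 = diag3 0 0 (x * ('X * (1 - 'X))).
Proof.
by rewrite !expr2 !mx3M; apply: eq_mx3 => -[|[|[|//]]] [|[|[|//]]] _ _ /=; ring.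
Qed.

Variables (B : algType F) (a b : B).
Hypotheses (a3 : a ^+ 3 = 0) (b3 : b ^+ 3 = 0).
Hypothesis aabE : a ^+ 2 * b + a * b * a + b * a ^+ 2 = a.
Hypothesis abbE : a * b ^+ 2 + b * a * b + b ^+ 2 * a = b.
Hypothesis genB : forall u : B, subalg_gen (fun x => x = a \/ x = b) u.
Variable rho : {rmorphism B -> 'M[{poly F}]_3}.
Hypothesis rhoZ : forall c x, rho (c *: x) = c%:P *: rho x.
Hypotheses (rho_a : rho a = amx) (rho_b : rho b = bmx).

Local Notation ev := (@horner_alg F B).

Lemma rho_horner_alg x d0 d1 d2 : rho x = diag3 d0 d1 d2 -> forall h,
  rho (ev x h) = diag3 (h \Po d0) (h \Po d1) (h \Po d2).
Proof.
move=> rx; elim/poly_ind=> [|h c IH].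
  by rewrite !rmorph0 ?comp_poly0 diag3_scalar raddf0.
rewrite !comp_polyD !comp_polyM !comp_polyX !comp_polyC !rmorphD !rmorphM /=.
rewrite horner_algX horner_algC rhoZ IH rx -diag3D -diag3M rmorph1.
by congr (_ + _); rewrite diag3_scalar scalemx1.
Qed.

(* The entries with [i = 0] or [k = 0] determine [h i k] there, and successively
   so do the others: the family is triangular in [minn i k]. *)
Definition normal_mx (h : nat -> nat -> {poly F}) : 'M[{poly F}]_3 :=
  mx3 (fun i j => nth 0 (nth [::] [::
    [:: h 0%N 0%N; h 0%N 1%N * 'X; h 0%N 2%N * ('X * (1 - 'X))];
    [:: h 1%N 0%N; (h 0%N 0%N \Po (1 - 'X)) + h 1%N 1%N * 'X;
        (h 0%N 1%N \Po (1 - 'X)) * (1 - 'X) + h 1%N 2%N * ('X * (1 - 'X))];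
    [:: h 2%N 0%N; (h 1%N 0%N \Po (1 - 'X)) + h 2%N 1%N * 'X;
        (h 0%N 0%N \Po 0) + (h 1%N 1%N \Po (1 - 'X)) * (1 - 'X)
        + h 2%N 2%N * ('X * (1 - 'X))]] i) j).

Lemma rho_normal (h : nat -> nat -> {poly F}) :
  rho (\sum_(i < 3) \sum_(k < 3) a ^+ i * ev (b * a) (h i k) * b ^+ k) = normal_mx h.
Proof.
have rq : rho (b * a) = diag3 'X (1 - 'X) 0.
  by rewrite rmorphM /= rho_a rho_b bmx_amx.
rewrite !big_ord_recl !big_ord0 !expr0 !expr1 !expr2 /= !addr0 !mul1r !mulr1.
rewrite !(rmorphD, rmorphM) /= !(rho_horner_alg rq) rho_a rho_b !comp_polyXr.
rewrite /diag3 !(mx3M, mx3D).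
by apply: eq_mx3 => -[|[|[|//]]] [|[|[|//]]] _ _ /=; ring.
Qed.

(** Each h i k enters its own entry with a factor 1, 'X or 'X (1 - 'X), cancellable in the domain of
    polynomials. *)
Lemma normal_mx_eq0 h : normal_mx h = 0 ->
  forall i k, (i < 3)%N -> (k < 3)%N -> h i k = 0.
Proof.
move=> h0.
have E i j := mx3_eq0 (i := i) (j := j) h0.
have X0 : ('X : {poly F}) != 0 by rewrite polyX_eq0.
have Y0 : (1 - 'X : {poly F}) != 0 by rewrite -oppr_eq0 opprB polyXsubC_eq0.
have XY0 : ('X * (1 - 'X) : {poly F}) != 0 by rewrite mulf_neq0.
have cancel (x y : {poly F}) : y != 0 -> x * y = 0 -> x = 0.
  by move=> y0 /eqP; rewrite mulf_eq0 (negbTE y0) orbF => /eqP.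
have h00 := E 0%N 0%N isT isT; have h10 := E 1%N 0%N isT isT.
have h20 := E 2%N 0%N isT isT.
have h01 := cancel _ _ X0 (E 0%N 1%N isT isT).
have h02 := cancel _ _ XY0 (E 0%N 2%N isT isT).
move: (E 1%N 1%N isT isT) (E 1%N 2%N isT isT) (E 2%N 1%N isT isT).
rewrite /= in h00 h10 h20 *; rewrite h00 h10 h01 !comp_poly0 mul0r !add0r.
move=> /(cancel _ _ X0) h11 /(cancel _ _ XY0) h12 /(cancel _ _ X0) h21.
have := E 2%N 2%N isT isT; rewrite /= h00 h11 !comp_poly0 mul0r !add0r.
move=> /(cancel _ _ XY0) h22.
by move=> [|[|[|//]]] [|[|[|//]]].
Qed.

Lemma normal_form u : exists h : nat -> nat -> {poly F},
  u = \sum_(i < 3) \sum_(k < 3) a ^+ i * ev (b * a) (h i k) * b ^+ k.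
Proof.
exact: (subalg_gen_normal a3 b3 aabE abbE erefl erefl erefl (genB u)).
Qed.

Lemma rho_inj : injective rho.
Proof.
suff rho0 u : rho u = 0 -> u = 0 by exact: raddf_inj rho0.
have [h ->] := normal_form u.
rewrite rho_normal => /normal_mx_eq0 h0.
by rewrite big1 // => i _; rewrite big1 // => k _; rewrite h0 // rmorph0 mulr0 mul0r.
Qed.

(** The endpoint condition comes from the vertex q = 1, reached at t = 1 on the side p = 0 and at t
    = 0 on the side r = 0. *)
Lemma centre_rho u : centre u <-> exists2 g, rho u = g%:M & g.[0] = g.[1].
Proof.
split=> [Zu|[g ug _] v]; last first.
  by apply: rho_inj; rewrite !rmorphM /= ug; exact: (esym (scalar_mxC _ _)).
have ug : rho u = (rho u 0 0)%:M.
  by apply: comm_amx_bmx; rewrite -?rho_a -?rho_b /GRing.comm -!rmorphM Zu.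
exists (rho u 0 0) => //; have [h uE] := normal_form u.
have hE : normal_mx h = diag3 (rho u 0 0) (rho u 0 0) (rho u 0 0).
  by rewrite diag3_scalar -ug uE rho_normal.
have /= <- := mx3_inj hE (i := 0) (j := 0) isT isT.
have /= := mx3_inj hE (i := 1) (j := 1) isT isT.
have /= <- := mx3_inj hE (i := 0) (j := 0) isT isT.
(* The entries (0,0) and (1,1) give g = h00 and g = h00(1 - 'X) + h11 'X; at 0 the second reads g(0)
   = h00(1) = g(1). *)
move=> /(congr1 (fun f : {poly F} => f.[0])).
by rewrite !hornerE horner_comp !hornerE subr0 => ->.
Qed.

Definition central_poly n : {poly F} :=
  'X * (1 - 'X) * ((1 - 'X) ^+ n + 2 * 'X ^+ n).

(* [calZ], with the generators of the envelope replaced by [a] and [b]. *)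
Definition central_elt (m : nat) : B :=
  (\sum_(1 <= j < m.-1)
      ((-1) ^+ j.+1 * 'C(m - 1, j - 1)%:R : F)
        *: ((b * a) ^+ j - a * (b * a) ^+ (j - 1) * b)) *~ deltahat m
  + ((b * a) ^+ (m - 1)) *~ gamma1 m
  + ((b * a) ^+ m) *~ gamma2 m
  + (a * (b * a) ^+ (m - 1) * b) *~ gamma3 m
  + (a * (b * a) ^+ (m - 2) * b) *~ gamma4 m
  + (a ^+ 2 * (b * a) ^+ (m - 2) * b ^+ 2) *+ 3.

Lemma rho_central_elt n : rho (central_elt n.+2) = (central_poly n)%:M.
Proof.
rewrite -diag3_scalar.
have rq : rho (b * a) = diag3 'X (1 - 'X) 0.
  by rewrite rmorphM /= rho_a rho_b bmx_amx.
pose T : {poly F} -> {poly F} := @truncated_binomial _ n.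
pose Y : {poly F} := 1 - 'X.
have sumE : rho ((\sum_(1 <= j < n.+1)
      ((-1) ^+ j.+1 * 'C(n.+1, j - 1)%:R : F)
        *: ((b * a) ^+ j - a * (b * a) ^+ (j - 1) * b)) *~ deltahat n.+2)
    = diag3 (T 'X * 'X) (T Y * Y - T 'X * 'X) (- (T Y * Y)).
  transitivity (rho (\sum_(1 <= j < n.+1)
      ((-1) ^+ j.+1 * 'C(n.+1, j - 1)%:R : F)
        *: ((b * a) ^+ j - a * (b * a) ^+ (j - 1) * b))).
    (* For m = 2 the sum is empty, so the factor [deltahat] may be dropped for every m. *)
    by case: n @T => [|n] _; rewrite ?mulr1z // big_geq // mul0rz.
  rewrite big_add1 big_mkord rmorph_sum /=.
  pose c i : {poly F} := (-1) ^+ i * 'C(n.+1, i)%:R.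
  transitivity (\sum_(i < n) diag3 (c i * 'X ^+ i * 'X)
      (c i * Y ^+ i * Y - c i * 'X ^+ i * 'X) (- (c i * Y ^+ i * Y))).
    apply: eq_bigr => i _; rewrite rhoZ subn1 [_.-1]/= (rmorphB rho) !(rmorphM rho).
    rewrite !(rmorphXn rho) (rmorphM rho) rho_a rho_b bmx_amx !diag3X amx_diag_bmx.
    rewrite -[- diag3 _ _ _]scaleN1r diag3Z diag3D diag3Z.
    (* With j = i + 1 the sign (-1)^(j+1) is (-1)^i. *)
    have -> : ((-1) ^+ i.+2 * 'C(n.+1, i)%:R)%:P = c i.
      rewrite rmorphM rmorphXn rmorphN rmorph1 rmorph_nat !exprS.
      by rewrite mulrA mulrNN !mul1r.
    rewrite -/Y !exprS; move: ('X ^+ i) (Y ^+ i) (c i) => y z {}c; congr diag3; ring.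
  rewrite diag3_sum /= sumrN sumrB -!mulr_suml //.
rewrite /central_elt !subSS !subn0 /= 5!rmorphD /= sumE rmorphMn !rmorphMz /=.
rewrite !(rmorphXn rho) !(rmorphM rho) !(rmorphXn rho) ?(rmorphM rho).
rewrite rho_a rho_b bmx_amx.
rewrite !diag3X amx2_diag_bmx2 !amx_diag_bmx.
rewrite !diag3Mz -scaler_nat diag3Z !diag3D expr0n /=.
have e12 := truncated_binomial12 n; have e34 := truncated_binomial34 n.
rewrite /central_poly -/Y; congr diag3.
- rewrite -(e12 _ 'X) !exprS /T; ring.
(* The middle entry is the first identity at 1 - 'X minus the second at 'X; the last entry uses only
   the second, at 1 - 'X, and the term with coefficient 3. *)
- transitivity (Y * (1 - Y) * ((1 - Y) ^+ n + 2 * Y ^+ n)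
      - 'X * (1 - 'X) * ((1 - 'X) ^+ n - 'X ^+ n)).
    rewrite -e12 -e34 !exprS /T; ring.
  by rewrite /Y subKr; ring.
- transitivity (3 * ('X ^+ n * ('X * Y)) - Y * (1 - Y) * ((1 - Y) ^+ n - Y ^+ n)).
    rewrite -e34 !exprS /T; ring.
  by rewrite /Y subKr; ring.
Qed.

(** * The elements Z(m) generate the centre *)

Hypothesis charF0 : [pchar F] =i pred0.

(** This number, 1 or 3, is the coefficient of 'X^n in (1 - 'X)^n + 2 'X^n. *)
Lemma sign_add2_neq0 n : (-1) ^+ n + 2 != 0 :> F.
Proof.
rewrite -signr_odd; case: (odd n); rewrite ?expr0 ?expr1.
  by rewrite addrC addrK oner_neq0.
by rewrite nat1r; have := charF0 3; rewrite !inE /= => ->.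
Qed.

Definition zgen (z : B) : Prop := exists2 m : nat, (2 <= m)%N & z = central_elt m.

(** The cofactors of 'X (1 - 'X) in the [central_poly n] have degree exactly n, so they form a
    triangular basis of the polynomials; the induction is on a bound for the size of [h]. *)
Lemma central_poly_mul_span (h : {poly F}) :
  exists2 z, subalg_gen zgen z & rho z = ('X * (1 - 'X) * h)%:M.
Proof.
elim: {h}(size h) {-2}h (leqnn (size h)) => [|n IH] h hn.
  exists (0 *: 1); first exact/SubalgScale/SubalgOne.
  move: hn; rewrite leqn0 size_poly_eq0 => /eqP->.
  by rewrite scale0r mulr0 !raddf0.
pose k : {poly F} := (1 - 'X) ^+ n + 2 * 'X ^+ n.
have kn : k`_n = (-1) ^+ n + 2.
  rewrite coefD mulr_natl coefMn coefXn eqxx -opprB (exprNn ('X - 1)).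
  have -> : (-1) ^+ n = ((-1) ^+ n)%:P :> {poly F} by rewrite rmorphXn rmorphN1.
  rewrite coefCM -polyC1; congr (_ + _).
  have := monic_exp n (monicXsubC (1 : F)).
  by rewrite monicE lead_coefE size_exp_XsubC /= => /eqP->; rewrite mulr1.
have sk : (size k <= n.+1)%N.
  rewrite (leq_trans (size_polyD _ _)) // geq_max.
  rewrite -opprB (exprNn ('X - 1)) size_Msign.
  rewrite -polyC1 size_exp_XsubC leqnn /= mulr_natl -scaler_nat.
  by rewrite (leq_trans (size_scale_leq _ _)) // size_polyXn.
(* This multiple of k cancels the coefficient of 'X^n in h. *)
pose c := h`_n / k`_n.
have [|z Zz rz] := IH (h - c *: k).
  apply/leq_sizeP => j; rewrite leq_eqVlt => /orP[/eqP<-|nj].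
    by rewrite coefB coefZ divfK ?subrr // kn sign_add2_neq0.
  by rewrite coefB coefZ !nth_default ?mulr0 ?subrr // (leq_trans _ nj).
exists (z + c *: central_elt n.+2).
  by apply/SubalgAdd/SubalgScale/SubalgGen => //; exists n.+2.
rewrite rmorphD /= rhoZ rz rho_central_elt scale_scalar_mx -raddfD /=.
congr (_%:M); rewrite /central_poly -/k -mul_polyC; ring.
Qed.

Lemma centre_subalg_gen u : centre u <-> subalg_gen zgen u.
Proof.
split=> [/centre_rho[g ug g01]|]; last first.
  rewrite /centre /GRing.comm.
  elim=> {u} [_ [[|[|n]] // _ ->]||c x _ cx|x y _ cx _ cy|x y _ cx _ cy] v.
  - apply: (centre_rho _).2; exists (central_poly n); first exact: rho_central_elt.
    by rewrite !hornerE subrr !mul0r.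
  - by rewrite mul1r mulr1.
  - by rewrite -scalerAl cx scalerAr.
  - by rewrite mulrDl cx cy -mulrDr.
  - by rewrite -mulrA cy mulrA cx mulrA.
(* Since g(0) = g(1), g - g(0) vanishes at both 0 and 1; the sign of the witness turns the factor 'X
   - 1 into 1 - 'X. *)
have [h gE] : exists h, g = g.[0]%:P + 'X * (1 - 'X) * h.
  have /factor_theorem[k kE] : root (g - g.[0]%:P) 0 by rewrite /root !hornerE subrr.
  have /factor_theorem[h hE] : root k 1.
    rewrite /root; have := congr1 (horner^~ 1) kE; rewrite /= !hornerE -g01 subrr.
    by rewrite subr0 mulr1 => <-.
  exists (- h); apply/eqP; rewrite -subr_eq0 opprD addrA kE hE; apply/eqP.
  by rewrite polyC0 polyC1; ring.
have [z Zz rz] := central_poly_mul_span h.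
suff -> : u = g.[0] *: 1 + z by apply/SubalgAdd/Zz/SubalgScale/SubalgOne.
apply: rho_inj; rewrite rmorphD /= rhoZ rmorph1 rz ug {1}gE raddfD /=.
by rewrite scalemx1.
Qed.

End Representation.

(** * The envelope *)

Section Symsum.
Variables (F : fieldType) (B : algType F).
Implicit Types x y z : B.

Lemma circC x y : circ x y = circ y x.
Proof. by rewrite /circ addrC. Qed.

Lemma symsumC12 x y z : symsum x y z = symsum y x z.
Proof.
by rewrite /symsum [circ y z]circC [circ z x]circC (circC x y) [x * _ + _]addrC.
Qed.

Lemma symsumC23 x y z : symsum x y z = symsum x z y.
Proof. by rewrite /symsum [circ y z]circC [circ z x]circC (circC x y) addrAC. Qed.

Hypothesis charF0 : [pchar F] =i pred0.

Lemma natr_neq0 n : n.+1%:R != 0 :> F.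
Proof. by rewrite ((pcharf0P _).1 charF0). Qed.

(** The repeated argument doubles each Jordan product, which cancels the factor 1/2. *)
Lemma symsum_xxy x y : symsum x x y = x ^+ 2 * y + x * y * x + y * x ^+ 2.
Proof.
have halfK (v : B) : 2^-1 *: (v + v) = v.
  by rewrite -mulr2n -scaler_nat scalerA mulVf ?scale1r ?natr_neq0.
rewrite /symsum (circC y x) -mulrDr /circ -scalerDr !halfK.
by rewrite mulrDr !expr2 !mulrA.
Qed.

Lemma symsum_xxx_eq0 x : symsum x x x = 0 -> x ^+ 3 = 0.
Proof.
have -> : symsum x x x = x ^+ 3 *+ 3.
  by rewrite symsum_xxy !exprS expr0 !mulr1 mulrA !mulrS mulr0n addr0 addrA.
move/eqP; rewrite -scaler_nat scaler_eq0 (negbTE (natr_neq0 2)) => /eqP//.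
Qed.

End Symsum.

Lemma lrmorph_symsum (F : fieldType) (B C : algType F) (f : {lrmorphism B -> C})
    x y z :
  f (symsum x y z) = symsum (f x) (f y) (f z).
Proof.
have fcirc u v : f (circ u v) = circ (f u) (f v).
  by rewrite /circ linearZ /= rmorphD !rmorphM.
by rewrite /symsum 2!rmorphD 3!rmorphM /= !fcirc.
Qed.

(** * The four relators of the envelope *)

Section ZdSymsum.
Variable F : fieldType.
Hypothesis charF0 : [pchar F] =i pred0.
Implicit Types x y z : zdmat F.

Lemma zdsymsumC12 x y z : zdsymsum x y z = zdsymsum y x z.
Proof. by apply: val_inj; exact: symsumC12. Qed.

Lemma zdsymsumC23 x y z : zdsymsum x y z = zdsymsum x z y.
Proof. by apply: val_inj; exact: symsumC23. Qed.

Let d (i j : 'I_2) : 'M[F]_2 := delta_mx i j.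

Lemma dM i j k l : d i j * d k l = if j == k then d i l else 0.
Proof.
by rewrite /d; case: eqP => [<-|/eqP];
  [exact: mul_delta_mx | exact: mul_delta_mx_0].
Qed.

Lemma zdsymsum111 : zdsymsum (e1 F) (e1 F) (e1 F) = 0.
Proof.
apply: val_inj; rewrite /= symsum_xxy // -/(d 0 1) !expr2 !dM /=.
by rewrite !(mul0r, mulr0, addr0).
Qed.

Lemma zdsymsum222 : zdsymsum (e2 F) (e2 F) (e2 F) = 0.
Proof.
apply: val_inj; rewrite /= symsum_xxy // -/(d 1 0) !expr2 !dM /=.
by rewrite !(mul0r, mulr0, addr0).
Qed.

Lemma zdsymsum112 : zdsymsum (e1 F) (e1 F) (e2 F) = e1 F.
Proof.
apply: val_inj; rewrite /= symsum_xxy // -/(d 0 1) -/(d 1 0) !expr2 !dM /=.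
by rewrite !(mul0r, mulr0, addr0, add0r).
Qed.

Lemma zdsymsum221 : zdsymsum (e2 F) (e2 F) (e1 F) = e2 F.
Proof.
apply: val_inj; rewrite /= symsum_xxy // -/(d 0 1) -/(d 1 0) !expr2 !dM /=.
by rewrite !(mul0r, mulr0, addr0, add0r).
Qed.

Local Notation a := (fa F).
Local Notation b := (fb F).
Local Notation relator_of x y z :=
  (symsum (phi x) (phi y) (phi z) - phi (zdsymsum x y z)).

Lemma relator111 : relator_of (e1 F) (e1 F) (e1 F) = symsum a a a.
Proof. by rewrite zdsymsum111 raddf0 subr0 phi_e1. Qed.

Lemma relator222 : relator_of (e2 F) (e2 F) (e2 F) = symsum b b b.
Proof. by rewrite zdsymsum222 raddf0 subr0 phi_e2. Qed.

Lemma relator112 : relator_of (e1 F) (e1 F) (e2 F) = symsum a a b - a.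
Proof. by rewrite zdsymsum112 phi_e1 phi_e2. Qed.

Lemma relator221 : relator_of (e2 F) (e2 F) (e1 F) = symsum b b a - b.
Proof. by rewrite zdsymsum221 phi_e1 phi_e2. Qed.

(** By symmetry the eight triples of basis vectors reduce to four multisets. *)
Lemma relatorP p : relator p <->
  [\/ p = symsum a a a, p = symsum a a b - a, p = symsum b b a - b
    | p = symsum b b b].
Proof.
split=> [[x y z]|].
  rewrite !inE => /orP[]/eqP-> /orP[]/eqP-> /orP[]/eqP->.
  - apply: Or41; exact: relator111.
  - apply: Or42; exact: relator112.
  - apply: Or42; rewrite symsumC23 zdsymsumC23; exact: relator112.
  - apply: Or43; rewrite symsumC12 symsumC23 zdsymsumC12 zdsymsumC23.
    exact: relator221.
  - apply: Or42; rewrite symsumC12 symsumC23 zdsymsumC12 zdsymsumC23.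
    exact: relator112.
  - apply: Or43; rewrite symsumC23 zdsymsumC23; exact: relator221.
  - apply: Or43; exact: relator221.
  - apply: Or44; exact: relator222.
have in1 : e1 F \in [:: e1 F; e2 F] by rewrite !inE eqxx.
have in2 : e2 F \in [:: e1 F; e2 F] by rewrite !inE eqxx orbT.
case=> ->; [rewrite -relator111 | rewrite -relator112 | rewrite -relator221 |
  rewrite -relator222]; exact: Relator.
Qed.

End ZdSymsum.

(** * The relations and the representation of the envelope *)

Section Env.
Variable F : fieldType.
Hypothesis charF0 : [pchar F] =i pred0.
Local Notation a := (fa F).
Local Notation b := (fb F).

Lemma env_pi_eq0 p : ideal_gen (@relator F) p -> env_pi p = 0.
Proof.
move=> Ip; rewrite -(rmorph0 (@env_pi F)); apply/quot_algP.
by rewrite subr0; apply/env_relP.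
Qed.

Lemma env_pi_symsum (x y z : free_alg F) :
  env_pi (symsum x y z) = symsum (env_pi x) (env_pi y) (env_pi z).
Proof. exact: (lrmorph_symsum (@env_pi F)). Qed.

Lemma ea_cube : ea F ^+ 3 = 0.
Proof.
apply: symsum_xxx_eq0 => //; rewrite -env_pi_symsum.
by apply/env_pi_eq0/IdealGen/relatorP => //; exact: Or41.
Qed.

Lemma eb_cube : eb F ^+ 3 = 0.
Proof.
apply: symsum_xxx_eq0 => //; rewrite -env_pi_symsum.
by apply/env_pi_eq0/IdealGen/relatorP => //; exact: Or44.
Qed.

Lemma ea_eb : ea F ^+ 2 * eb F + ea F * eb F * ea F + eb F * ea F ^+ 2 = ea F.
Proof.
rewrite -symsum_xxy // -env_pi_symsum; apply/eqP; rewrite -subr_eq0 -rmorphB.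
by apply/eqP/env_pi_eq0/IdealGen/relatorP => //; exact: Or42.
Qed.

Lemma eb_ea : ea F * eb F ^+ 2 + eb F * ea F * eb F + eb F ^+ 2 * ea F = eb F.
Proof.
rewrite addrC addrA addrAC -symsum_xxy // -env_pi_symsum; apply/eqP.
rewrite -subr_eq0 -rmorphB.
by apply/eqP/env_pi_eq0/IdealGen/relatorP => //; exact: Or43.
Qed.

Lemma free_alg_gen (g : free_alg F) :
  subalg_gen (fun x => x = a \/ x = b) g.
Proof.
have word (w : seq 'I_2) :
    subalg_gen (fun x => x = a \/ x = b) (<< FMonom w >> : free_alg F).
  elim: w => [|i w IH].
    have -> : << FMonom [::] >> = 1 :> free_alg F.
      by rewrite -mpolyC1E; congr << _ *g _ >>; apply: val_inj; rewrite /= fm1.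
    exact: SubalgOne.
  have -> : << FMonom (i :: w) >> = << fmu i >> * << FMonom w >> :> free_alg F.
    rewrite malgM_def fgmulUU mulr1; congr << _ *g _ >>.
    by apply: val_inj; rewrite /= fmM fmuE.
  apply: SubalgMul => //; apply: SubalgGen.
  by case: i => [[|[|//]] ?]; [left | right]; congr << _ *g fmu _ >>; apply: val_inj.
rewrite (monalgE g); elim/big_ind: _ => [|x y|w _].
- by have := SubalgScale 0 (SubalgOne (fun x => x = a \/ x = b)); rewrite scale0r.
- exact: SubalgAdd.
- have -> : << g@_w *g w >> = g@_w *: << w >> :> free_alg F.
    by rewrite -mul_malgC malgM_def fgmulUU mulr1 mul1m.
  by case: w => w; exact/SubalgScale/word.
Qed.

Lemma env_repr (u : env F) : u = env_pi (repr u).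
Proof. by rewrite /env_pi /quot_alg_pi reprK. Qed.

Lemma env_gen (u : env F) : subalg_gen (fun x => x = ea F \/ x = eb F) u.
Proof.
rewrite (env_repr u); elim: (free_alg_gen (repr u)) =>
  {u} [x [] ->||c x _ IH|x y _ IHx _ IHy|x y _ IHx _ IHy].
- by apply: SubalgGen; left.
- by apply: SubalgGen; right.
- by rewrite rmorph1; exact: SubalgOne.
- by rewrite linearZ; exact: SubalgScale.
- by rewrite rmorphD; exact: SubalgAdd.
- by rewrite rmorphM; exact: SubalgMul.
Qed.

Definition word_rep (w : {fmonom 'I_2}) : 'M[{poly F}]_3 :=
  \prod_(i <- (w : seq 'I_2)) (if i == 0 then amx F else bmx F).

Lemma word_rep_is_multiplicative : monalg.mmorphism word_rep.
Proof.
by split=> [v w|]; rewrite /word_rep ?fmM ?fm1 ?big_nil // big_cat.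
Qed.

HB.instance Definition _ :=
  monalg.isMultiplicative.Build {fmonom 'I_2} 'M[{poly F}]_3
  word_rep word_rep_is_multiplicative.

Definition const_mx3 : F -> 'M[{poly F}]_3 := @scalar_mx {poly F} 3 \o polyC.
HB.instance Definition _ := GRing.RMorphism.on const_mx3.

Definition free_rep : free_alg F -> 'M[{poly F}]_3 := mmap const_mx3 word_rep.

Lemma free_rep_multiplicative : multiplicative free_rep.
Proof.
by apply: commr_mmap_is_multiplicative => g m m'; exact: (esym (scalar_mxC _ _)).
Qed.

HB.instance Definition _ :=
  GRing.isAdditive.Build (free_alg F) 'M[{poly F}]_3 free_rep
  (mmapB (f := const_mx3)).

HB.instance Definition _ :=
  GRing.isMultiplicative.Build (free_alg F) 'M[{poly F}]_3 free_rep
  free_rep_multiplicative.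

Lemma free_repZ c x : free_rep (c *: x) = c%:P *: free_rep x.
Proof. by rewrite -mul_scalar_mx; exact: (@mmapZ _ _ _ const_mx3 word_rep). Qed.

Lemma free_rep_a : free_rep a = amx F.
Proof.
rewrite /free_rep /fa (mmapU (f := const_mx3)) mul1r /= /word_rep fmU.
by rewrite big_seq1.
Qed.

Lemma free_rep_b : free_rep b = bmx F.
Proof.
rewrite /free_rep /fb (mmapU (f := const_mx3)) mul1r /= /word_rep fmU.
by rewrite big_seq1.
Qed.

Lemma free_rep_symsum x y : free_rep (symsum x x y) =
  free_rep x ^+ 2 * free_rep y + free_rep x * free_rep y * free_rep x
  + free_rep y * free_rep x ^+ 2.
Proof.
by rewrite symsum_xxy // 2!(rmorphD free_rep) !expr2 !(rmorphM free_rep).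
Qed.

(** The four relators vanish by [amx3], [aabmx], [abbmx] and [bmx3], so the representation descends
    to the quotient. *)
Lemma free_rep_ideal p : ideal_gen (@relator F) p -> free_rep p = 0.
Proof.
elim=> {p} [p /relatorP [] // ->||x y _ x0 _ y0|c x _ x0|c x _ x0].
- by rewrite free_rep_symsum free_rep_a -!exprSr -exprS amx3 !addr0.
- rewrite (rmorphB free_rep) /= free_rep_symsum free_rep_a free_rep_b.
  by rewrite aabmx subrr.
- rewrite (rmorphB free_rep) /= free_rep_symsum free_rep_a free_rep_b.
  have -> : bmx F ^+ 2 * amx F + bmx F * amx F * bmx F + amx F * bmx F ^+ 2 = bmx F.
    by rewrite addrC addrA addrAC abbmx.
  by rewrite subrr.
- by rewrite free_rep_symsum free_rep_b -!exprSr -exprS bmx3 !addr0.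
- exact: rmorph0.
- by rewrite rmorphD /= x0 y0 addr0.
- by rewrite rmorphM /= x0 mulr0.
- by rewrite rmorphM /= x0 mul0r.
Qed.

Definition env_rep (u : env F) : 'M[{poly F}]_3 := free_rep (repr u).

(** The chosen representative differs from [p] by an element of the ideal, which [free_rep]
    kills. *)
Lemma env_rep_pi p : env_rep (env_pi p) = free_rep p.
Proof.
apply/eqP; rewrite -subr_eq0 -rmorphB; apply/eqP/free_rep_ideal/env_relP.
exact: (repr_pi_quot_alg (env_ideal F)).
Qed.

Lemma env_rep_is_zmod_morphism : zmod_morphism env_rep.
Proof.
move=> u v; rewrite (env_repr u) (env_repr v) -rmorphB !env_rep_pi; exact: rmorphB.
Qed.

Lemma env_rep_is_monoid_morphism : monoid_morphism env_rep.
Proof.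
split=> [|u v]; first by rewrite -(rmorph1 (@env_pi F)) env_rep_pi; exact: rmorph1.
rewrite (env_repr u) (env_repr v) -rmorphM !env_rep_pi; exact: rmorphM.
Qed.

HB.instance Definition _ :=
  GRing.isZmodMorphism.Build (env F) 'M[{poly F}]_3 env_rep env_rep_is_zmod_morphism.
HB.instance Definition _ :=
  GRing.isMonoidMorphism.Build (env F) 'M[{poly F}]_3 env_rep
  env_rep_is_monoid_morphism.

Lemma env_repZ c u : env_rep (c *: u) = c%:P *: env_rep u.
Proof. by rewrite (env_repr u) -linearZ /= !env_rep_pi; exact: free_repZ. Qed.

(** Unfolding shows [calZ] to be [central_elt] at the classes of a and b, so the result for an
    abstract algebra applies directly. *)
Lemma centre_env (u : env F) :
  centre u <-> subalg_gen (fun z => exists2 m : nat, (2 <= m)%N & z = calZ F m) u.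
Proof.
have rep_a : env_rep (ea F) = amx F by rewrite env_rep_pi free_rep_a.
have rep_b : env_rep (eb F) = bmx F by rewrite env_rep_pi free_rep_b.
exact: (@centre_subalg_gen F (env F) _ _ ea_cube eb_cube ea_eb eb_ea env_gen env_rep
  env_repZ rep_a rep_b charF0).
Qed.

End Env.

Unset Implicit Arguments.
Local Close Scope ring_scope.

Theorem theorem4p16 (F : fieldType) (charF0 : [pchar F]%R =i pred0)
    (u : env F) :
  centre u <->
  subalg_gen (fun z : env F => exists2 m : nat, 2 <= m & z = calZ F m) u.
Proof. exact: centre_env. Qed.
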